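(* Let $Q_0=\{1,2,\dots,m\}$ be the vertex set of a quiver, where $m$ divides $n$, and let $\mathbb{Z}_n=\langle g\rangle$ act on $\Bbbk Q_0$ by $g\cdot e_i=e_{i+1}$, subscripts interpreted modulo $m$. Consider $T(n)$-actions on $\Bbbk Q_0$ extending this $\mathbb Z_n$-action. (i) If $m<n$ (so the $\mathbb{Z}_n$-action on $Q_0$ is not faithful), then $x$ acts on $\Bbbk Q_0$ by $0$. (ii) If $m=n$ (so $\mathbb{Z}_n$ acts faithfully on $Q_0$), then the action of $x$ on $\Bbbk Q_0$ is exactly of the form $$x\cdot e_i=\gamma\zeta^i(e_i-\zeta e_{i+1})\quad\text{for all } i,$$ where $\gamma\in\Bbbk$ can be any scalar. In particular, the action of $\mathbb{Z}_n$ on $\Bbbk Q_0$ can be extended to an inner faithful action of $T(n)$ on $\Bbbk Q_0$ if and only if $m=n$.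
   Context: Let $n\ge2$ be an integer and $\Bbbk$ a field containing a primitive $n$-th root of unity $\zeta$. The Taft algebra $T(n)$ is the $n^2$-dimensional Hopf algebra generated by $g,x$ with relations $g^n=1$, $x^n=0$, $xg=\zeta gx$, and $\Delta(g)=g\otimes g$, $\Delta(x)=1\otimes x+x\otimes g$, $\varepsilon(g)=1$, $\varepsilon(x)=0$. The group generated by $g$ is identified with $\mathbb Z_n$. A Hopf algebra $H$ acts on an algebra $A$ if $A$ is a left $H$-module with $h\cdot(pq)=\sum(h_1\cdot p)(h_2\cdot q)$ and $h\cdot1_A=\varepsilon(h)1_A$. The action is inner faithful if it does not factor through a proper quotient Hopf algebra of $H$, i.e. $I\cdot A\neq0$ for every nonzero Hopf ideal $I\subset H$. $\Bbbk Q_0$ is the algebra $\Bbbk\times\cdots\times\Bbbk$ ($m$ factors) with primitive orthogonal idempotents $e_1,\dots,e_m$ (the path algebra of the arrowless quiver on $Q_0$). *)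

(* Defs.v *)
From HB Require Import structures.
From mathcomp Require Import all_boot all_order all_algebra all_field.

Set Implicit Arguments.
Unset Strict Implicit.
Unset Printing Implicit Defensive.

Import GRing.Theory.
Local Open Scope ring_scope.

(* The tensor product of two finite-dimensional spaces, in coordinates: entry *)
(* (i, j) is the coefficient of b_i (x) c_j for the chosen bases b of U and c *)
(* of V. Lemmas tensum_tens and tensum_id say that it has the universal       *)
(* property, so nothing depends on these bases.                               *)
Definition tensor (k : fieldType) (U V : vectType k) : Type :=
  'M[k]_(\dim {:U}, \dim {:V}).

HB.instance Definition _ (k : fieldType) (U V : vectType k) :=
  Vector.copy (tensor U V) 'M[k]_(\dim {:U}, \dim {:V}).

Section Tensor.
Variables (k : fieldType) (U V : vectType k).

Definition tens (u : U) (v : V) : tensor U V :=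
  \matrix_(i, j) (coord (vbasis {:U}) i u * coord (vbasis {:V}) j v).

(* For t = sum u_s (x) v_s and f bilinear, this is sum (f u_s v_s): the value *)
(* at t of the linear map induced by f.                                       *)
Definition tensum (W : lmodType k) (f : U -> V -> W) (t : tensor U V) : W :=
  \sum_i \sum_j
    (t : 'M_(_, _)) i j *: f (vbasis {:U})`_i (vbasis {:V})`_j.

Lemma tensum_tens (W : lmodType k) (f : U -> V -> W) u v :
    (forall u', linear (f u')) -> (forall v', linear (f^~ v')) ->
  tensum f (tens u v) = f u v.
Proof.
move=> lin2 lin1.
pose f2 u' : {linear V -> W} :=
  HB.pack (f u') (GRing.isLinear.Build k V W *:%R (f u') (lin2 u')).
pose f1 v' : {linear U -> W} :=
  HB.pack (f^~ v') (GRing.isLinear.Build k U W *:%R (f^~ v') (lin1 v')).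
rewrite [in RHS](coord_vbasis (memvf u)) -[RHS]/(f1 v _) linear_sum.
apply: eq_bigr => i _; rewrite linearZ /= -[f _ v]/(f2 _ v).
rewrite [in RHS](coord_vbasis (memvf v)) linear_sum scaler_sumr.
by apply: eq_bigr => j _; rewrite linearZ /= scalerA mxE.
Qed.

Lemma tens_linearr u : linear (tens u).
Proof.
by move=> a v w; apply/matrixP=> i j; rewrite !mxE linearP /= mulrDr mulrCA.
Qed.

Lemma tens_linearl v : linear (tens^~ v).
Proof.
by move=> a u w; apply/matrixP=> i j; rewrite !mxE linearP /= mulrDl mulrA.
Qed.

Lemma tensum_linear (W : lmodType k) (f : U -> V -> W) : linear (tensum f).
Proof.
move=> a s t; rewrite /tensum scaler_sumr -big_split; apply: eq_bigr => i _.
rewrite /= scaler_sumr -big_split; apply: eq_bigr => j _.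
by rewrite /= !mxE scalerDl scalerA.
Qed.

Lemma tensum_id t : tensum tens t = t.
Proof.
rewrite {2}[t](matrix_sum_delta (t : 'M_(_, _))).
apply: eq_bigr => i _; apply: eq_bigr => j _; congr (_ *: _).
apply/matrixP=> i' j'; rewrite !mxE.
have coordE (T : vectType k) (a b : 'I_(\dim {:T})) :
    coord (vbasis {:T}) a (vbasis {:T})`_b = (a == b)%:R.
  by rewrite coord_free 1?eq_sym ?(basis_free (vbasisP _)).
by rewrite !coordE -natrM mulnb.
Qed.

Definition tensv (I : {vspace U}) (J : {vspace V}) : {vspace tensor U V} :=
  <<[seq tens u v | u <- vbasis I, v <- vbasis J]>>%VS.

End Tensor.

Record hopfAlg (k : fieldType) := HopfAlg {
  hopf_sort :> falgType k;
  comul : {linear hopf_sort -> tensor hopf_sort hopf_sort};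
  counit : {lrmorphism hopf_sort -> k^o};
  antipode : {linear hopf_sort -> hopf_sort};
  comulA : forall h : hopf_sort,
    tensum (fun a b : hopf_sort =>
      tensum (fun a1 a2 : hopf_sort => tens a1 (tens a2 b)) (comul a))
      (comul h)
    = tensum (fun a b : hopf_sort => tens a (comul b)) (comul h);
  counitl : forall h : hopf_sort,
    tensum (fun a b : hopf_sort => counit a *: b) (comul h) = h;
  counitr : forall h : hopf_sort,
    tensum (fun a b : hopf_sort => counit b *: a) (comul h) = h;
  comul1 : comul 1 = tens (1 : hopf_sort) (1 : hopf_sort);
  comulM : forall h h' : hopf_sort,
    comul (h * h')
    = tensum (fun a b : hopf_sort =>
        tensum (fun c d : hopf_sort => tens (a * c : hopf_sort) (b * d : hopf_sort))
          (comul h'))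
        (comul h);
  antipodel : forall h : hopf_sort,
    tensum (fun a b : hopf_sort => antipode a * b) (comul h)
    = (counit h)%:A;
  antipoder : forall h : hopf_sort,
    tensum (fun a b : hopf_sort => a * antipode b) (comul h)
    = (counit h)%:A
}.

Arguments comul {k _}.
Arguments counit {k _}.
Arguments antipode {k _}.

Record hopf_ideal (k : fieldType) (H : hopfAlg k) (I : {vspace H}) : Prop :=
  HopfIdeal {
    hopf_ideal_mull : forall h y, y \in I -> h * y \in I;
    hopf_ideal_mulr : forall h y, y \in I -> y * h \in I;
    hopf_ideal_comul : forall y, y \in I ->
      comul y \in (tensv I {:H} + tensv {:H} I)%VS;
    hopf_ideal_counit : forall y, y \in I -> counit y = 0 :> k;
    hopf_ideal_antipode : forall y, y \in I -> antipode y \in I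
  }.

(* The algebra k x ... x k, with one factor for each element of Q0.           *)
Notation vertex_alg k Q0 := {ffun Q0 -> k^o}.

Record hopf_action (k : fieldType) (H : hopfAlg k) (Q0 : finType)
    (act : H -> vertex_alg k Q0 -> vertex_alg k Q0) : Prop := HopfAction {
  hopf_act_linearl : forall p, linear (act^~ p);
  hopf_act_linearr : forall h, linear (act h);
  hopf_act1 : forall p, act 1 p = p;
  hopf_actM : forall h h' p, act (h * h') p = act h (act h' p);
  hopf_act_mul : forall h (p q : vertex_alg k Q0),
    act h (p * q) = tensum (fun h1 h2 : H => act h1 p * act h2 q) (comul h);
  hopf_act_one : forall h, act h 1 = counit h *: (1 : vertex_alg k Q0)
}.

Definition inner_faithful (k : fieldType) (H : hopfAlg k) (Q0 : finType)
    (act : H -> vertex_alg k Q0 -> vertex_alg k Q0) : Prop :=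
  forall I : {vspace H}, hopf_ideal I -> I <> 0%VS ->
    exists h p, h \in I /\ act h p <> 0.

(* The relations alone make the n ^ 2 monomials g ^+ i * x ^+ j span the      *)
(* subalgebra generated by g and x, so the dimension requirement says that    *)
(* there are no further relations.                                            *)
Record is_taft (k : fieldType) (n : nat) (zeta : k) (H : hopfAlg k)
    (g x : H) : Prop := IsTaft {
  taft_dim : \dim {:H} = (n ^ 2)%N;
  taft_gen : agenv <<[:: g; x]>> = {:H}%VS;
  taft_gn : g ^+ n = 1;
  taft_xn : x ^+ n = 0;
  taft_xg : x * g = zeta *: (g * x);
  taft_comul_g : comul g = tens g g;
  taft_comul_x : comul x = tens (1 : H) x + tens x g;
  taft_counit_g : counit g = 1 :> k;
  taft_counit_x : counit x = 0 :> k
}.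

(* Subscripts are read modulo m, so the vertices 1, ..., m are represented by *)
(* 1, ..., m - 1, 0 in 'I_m.                                                  *)
Definition idem (k : fieldType) (m i : nat) : vertex_alg k 'I_m :=
  [ffun j : 'I_m => (j == i %[mod m])%:R].

Definition extends_rotation (k : fieldType) (H : hopfAlg k) (m : nat)
    (g : H) (act : H -> vertex_alg k 'I_m -> vertex_alg k 'I_m) : Prop :=
  hopf_action act /\ forall i : nat, act g (idem k m i) = idem k m i.+1.

(* Main.v *)
Require Import Defs.
From HB Require Import structures.
From mathcomp Require Import all_boot all_order all_algebra all_field.
From mathcomp Require Import ring.

(** Write e_i for the vertex idempotents. The coproduct of [x] makes it act as a
    skew derivation: x . (pq) = p (x . q) + (x . p)(g . q). If m = 1, the algebra
    is spanned by its unit, which x kills. If m >= 2, the products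
    e_i e_i = e_i and e_(i+1) e_i = 0 force x . e_i to be
    gamma_i e_i - gamma_(i+1) e_(i+1), and xg = zeta gx forces
    gamma_(i+1) = zeta gamma_i ([act_x_eigen], [act_x_idem]). Since gamma_i only
    depends on i modulo m, gamma_0 = zeta^m gamma_0, so x acts by zero when
    m < n ([act_x_eq0]), while m = n leaves gamma_0 free.

    Conversely, for m = n, the formula reads x . p = u (p - g . p) with
    u = sum_i gamma zeta^i e_i. The operators of g and of x satisfy the Taft
    relations, where x^n = 0 comes from the factorization of g^n - 1 into the
    g - zeta^l ([skew_expr_eq0]). The monomials g^i x^j form a basis of T(n)
    ([bmono_basis]), so operators satisfying the relations define a module
    ([taft_lift]), and the module algebra axioms may be checked on generators
    ([taft_hopf_action]).

    If m < n, the action is not inner faithful, because it annihilates the ideal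
    T(n) x. That this is a Hopf ideal ([x_hopf_ideal]) is immediate except for
    the antipode, which is read off the antipode axiom on each monomial.

    If m = n and gamma = 1, then u = sum_i zeta^i e_i and the algebra has the
    basis u^0, ..., u^(n-1), with g . u^b = zeta^(-b) u^b and
    x . u^b = (1 - zeta^(-b)) u^(b+1). This module is not faithful, but a
    Hopf ideal that annihilates it also annihilates its tensor square, which
    is faithful: it is isomorphic to the regular module. The proof extracts
    from this only the matrix coefficients it needs: contracting the
    coproduct against the u^a coefficient of the action on u^a keeps the
    ideal stable ([twist_ideal]), and evaluating the results at u for all a
    isolates every coefficient of an element of the ideal
    ([hopf_ideal_act0]). *)

Set Implicit Arguments.
Unset Strict Implicit.
Unset Printing Implicit Defensive.

Import GRing.Theory.
Local Open Scope ring_scope.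

(** * Linear maps out of a tensor product *)

HB.instance Definition _ (k : fieldType) (U V : vectType k) (W : lmodType k)
    (f : U -> V -> W) :=
  GRing.isLinear.Build k (tensor U V) W *:%R (tensum f) (tensum_linear f).

HB.instance Definition _ (k : fieldType) (U V : vectType k) (u : U) :=
  GRing.isLinear.Build k V (tensor U V) *:%R (@tens k U V u) (tens_linearr u).

Section TensorMaps.
Variables (k : fieldType) (U V : vectType k).
Implicit Types (t : tensor U V).

Lemma eq_tensum (W : lmodType k) (f f' : U -> V -> W) t :
  (forall u v, f u v = f' u v) -> tensum f t = tensum f' t.
Proof.
by move=> eqf; apply: eq_bigr => i _; apply: eq_bigr => j _; rewrite eqf.
Qed.

Lemma tensum_fun_linear (W : lmodType k) (a : k) (f f' : U -> V -> W) t :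
  tensum (fun u v => a *: f u v + f' u v) t = a *: tensum f t + tensum f' t.
Proof.
rewrite /tensum scaler_sumr -big_split; apply: eq_bigr => i _ /=.
rewrite scaler_sumr -big_split; apply: eq_bigr => j _ /=.
by rewrite scalerDr !scalerA mulrC.
Qed.

Lemma linear_tensum (W W' : lmodType k) (F : {linear W -> W'})
    (f : U -> V -> W) t :
  F (tensum f t) = tensum (fun u v => F (f u v)) t.
Proof.
rewrite /tensum linear_sum; apply: eq_bigr => i _.
by rewrite linear_sum; apply: eq_bigr => j _; rewrite linearZ.
Qed.

Lemma mem_tensum (W : vectType k) (f : U -> V -> W) (L : {vspace W}) t :
  (forall u v, f u v \in L) -> tensum f t \in L.
Proof.
by move=> fL; apply: memv_suml => i _; apply: memv_suml => j _; apply: memvZ.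
Qed.

Lemma mem_tensv (I : {vspace U}) (J : {vspace V}) u v :
  u \in I -> v \in J -> tens u v \in tensv I J.
Proof.
move=> uI vJ; rewrite (coord_vbasis vJ) linear_sum; apply: memv_suml => j _.
rewrite linearZ memvZ //= (coord_vbasis uI).
pose tl u' : tensor U V := tens u' (vbasis J)`_j.
pose tlL : {linear U -> tensor U V} := HB.pack tl
  (GRing.isLinear.Build k U (tensor U V) *:%R tl (tens_linearl _)).
rewrite -[tens _ _]/(tlL _) linear_sum; apply: memv_suml => i _.
rewrite linearZ memvZ //= memv_span //; apply/allpairsP.
exists ((vbasis I)`_i, (vbasis J)`_j).
by split=> //=; apply/mem_nth; rewrite size_tuple.
Qed.

(** Pure tensors of elements of [I] and [J] span [tensv I J], so the membership
    only has to be tested on them. *)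
Lemma tensum_tensv (W : vectType k) (f : U -> V -> W)
    (I : {vspace U}) (J : {vspace V}) (L : {vspace W}) t :
    (forall u, linear (f u)) -> (forall v, linear (f^~ v)) ->
    {in I & J, forall u v, f u v \in L} ->
  t \in tensv I J -> tensum f t \in L.
Proof.
move=> lin2 lin1 fL.
suff sub: (tensv I J <= linfun (tensum f) @^-1: L)%VS.
  by move=> /(subvP sub); rewrite -memv_preim lfunE.
apply/span_subvP => _ /allpairsP[[u v] /= [uI vJ ->]].
by rewrite -memv_preim lfunE /= tensum_tens // fL // vbasis_mem.
Qed.

End TensorMaps.

(** * The comultiplication of a product *)

Section HopfProduct.
Variables (k : fieldType) (H : hopfAlg k).

(** The product of the algebra H (x) H, for which [comul] is multiplicative. *)
Definition tens_mul (s t : tensor H H) : tensor H H :=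
  tensum (fun a b => tensum (fun c d => tens (a * c : H) (b * d : H)) t) s.

Lemma tens_mul_linearr s : linear (tens_mul s).
Proof.
move=> a t t'; rewrite /tens_mul -tensum_fun_linear; apply: eq_tensum => u v.
exact: tensum_linear.
Qed.

HB.instance Definition _ s :=
  GRing.isLinear.Build k (tensor H H) _ *:%R (tens_mul s) (tens_mul_linearr s).

Lemma tens_mul_tensr s (c d : H) :
  tens_mul s (tens c d) = tensum (fun a b => tens (a * c : H) (b * d : H)) s.
Proof.
apply: eq_tensum => a b; rewrite tensum_tens // => u e v w.
  by rewrite mulrDr -scalerAr tens_linearr.
by rewrite mulrDr -scalerAr tens_linearl.
Qed.

Lemma tens_mul_tens (a b c d : H) :
  tens_mul (tens a b) (tens c d) = tens (a * c : H) (b * d : H).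
Proof.
rewrite tens_mul_tensr tensum_tens // => u e v w.
  by rewrite mulrDl -scalerAl tens_linearr.
by rewrite mulrDl -scalerAl tens_linearl.
Qed.

Lemma comul_mul (h h' : H) : comul (h * h') = tens_mul (comul h) (comul h').
Proof. exact: comulM. Qed.

End HopfProduct.

(** * The monomial basis of the Taft algebra *)

Section Taft.
Variables (k : fieldType) (n : nat) (zeta : k).
Hypothesis n_ge2 : (2 <= n)%N.
Variables (H : hopfAlg k) (g x : H).
Hypothesis taftH : is_taft n zeta g x.

Let n_gt0 : (0 < n)%N := ltnW n_ge2.

Definition taft_mono (i j : nat) : H := g ^+ i * x ^+ j.

Lemma mono10 : taft_mono 1 0 = g. Proof. exact: mulr1. Qed.
Lemma mono01 : taft_mono 0 1 = x. Proof. exact: mul1r. Qed.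

Lemma mono_modl i j : taft_mono (i %% n) j = taft_mono i j.
Proof.
rewrite /taft_mono [in RHS](divn_eq i n) exprD mulnC exprM.
by rewrite (taft_gn taftH) expr1n mul1r.
Qed.

Lemma mono_nilp i j : (n <= j)%N -> taft_mono i j = 0.
Proof.
by move=> le_nj; rewrite /taft_mono -(subnK le_nj) exprD (taft_xn taftH) !mulr0.
Qed.

(** This and the next lemma give the straightening rule of the Taft relations.
    It is needed in H and again in every algebra that receives a map from H. *)
Lemma expr_skew_comm (R : algType k) (G X : R) i j :
  X * G = zeta *: (G * X) ->
  X ^+ j * G ^+ i = zeta ^+ (i * j) *: (G ^+ i * X ^+ j).
Proof.
move=> XG.
have XGi l : X * G ^+ l = zeta ^+ l *: (G ^+ l * X).
  elim: l => [|l IHl]; first by rewrite mulr1 mul1r scale1r.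
  rewrite [in LHS]exprS mulrA XG -scalerAl -mulrA IHl -scalerAr scalerA.
  by rewrite -exprS mulrA -exprS.
elim: j => [|j IHj]; first by rewrite muln0 mul1r mulr1 scale1r.
rewrite [in LHS]exprS -mulrA IHj -scalerAr mulrA XGi -scalerAl scalerA.
by rewrite -exprD mulnS addnC exprS mulrA.
Qed.

Lemma skew_monoM (R : algType k) (G X : R) a b i j :
  X * G = zeta *: (G * X) ->
  G ^+ a * X ^+ b * (G ^+ i * X ^+ j)
  = zeta ^+ (i * b) *: (G ^+ (a + i) * X ^+ (b + j)).
Proof.
move=> XG; rewrite mulrA -(mulrA (G ^+ a)) expr_skew_comm //.
by rewrite -scalerAr -scalerAl !exprD !mulrA.
Qed.

Lemma monoM a b i j :
  taft_mono a b * taft_mono i j = zeta ^+ (i * b) *: taft_mono (a + i) (b + j).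
Proof. exact: (skew_monoM _ _ _ _ (taft_xg taftH)). Qed.

Definition bmono (p : 'I_n * 'I_n) : H := taft_mono p.1 p.2.

Definition ord_n (i : nat) : 'I_n := Ordinal (ltn_pmod i n_gt0).

Lemma bmono_ord i j : (j < n)%N -> bmono (ord_n i, ord_n j) = taft_mono i j.
Proof. by move=> ltjn; rewrite /bmono /= mono_modl (modn_small ltjn). Qed.

Lemma mono_in_span i j : taft_mono i j \in <<codom bmono>>%VS.
Proof.
have [/(mono_nilp i)-> | ltjn] := leqP n j; first exact: mem0v.
by rewrite -bmono_ord // memv_span // codom_f.
Qed.

(** The span of the monomials contains 1 and is stable under left multiplication
    by [g] and [x], so it is all of H; the dimension then leaves no room for a
    linear dependence among [n ^ 2] of them. *)
Lemma bmono_basis : basis_of {:H} (codom_tuple bmono).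
Proof.
rewrite basisEdim; apply/andP; split; last first.
  by rewrite size_tuple card_prod card_ord (taft_dim taftH).
rewrite -(taft_gen taftH); apply: agenv_sub_modl.
  rewrite -memvE; have := mono_in_span 0 0.
  by rewrite /taft_mono !expr0 mulr1.
apply/prodvP => u v uV vV.
rewrite (coord_span (X := codom_tuple bmono) vV) mulr_sumr.
apply: memv_suml => q _; rewrite -scalerAr memvZ //.
have /codomP[[i j] ->] : (codom_tuple bmono)`_q \in codom bmono.
  by apply: mem_nth; rewrite size_tuple.
move: uV; rewrite span_cons span_seq1 => /memv_addP[_ /vlineP[a ->]].
case=> _ /vlineP[b ->] ->; rewrite mulrDl -!scalerAl.
rewrite -{1}mono10 -{1}mono01 /bmono !monoM.
by rewrite !(memvD, memvZ) ?mono_in_span.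
Qed.

Lemma taft_ind (P : H -> Prop) :
    (forall a h h', P h -> P h' -> P (a *: h + h')) ->
    (forall i j, P (taft_mono i j)) ->
  forall h, P h.
Proof.
move=> Plin Pmono h; rewrite (coord_basis bmono_basis (memvf h)).
have P0 : P 0 by rewrite -(mono_nilp 0 (leqnn n)); apply: Pmono.
elim/big_rec: _ => // q h' _ Ph'; apply: Plin => //.
have /codomP[[i j] ->] : (codom_tuple bmono)`_q \in codom bmono.
  by apply: mem_nth; rewrite size_tuple.
exact: Pmono.
Qed.

Definition monoc (p : 'I_n * 'I_n) : H -> k^o :=
  coord (codom_tuple bmono) (enum_rank p).

HB.instance Definition _ p := GRing.Linear.on (monoc p).

Lemma bmono_nth p : bmono p = (codom_tuple bmono)`_(enum_rank p).
Proof. by rewrite nth_codom enum_rankK. Qed.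

Lemma mono_expand h : h = \sum_p monoc p h *: bmono p.
Proof.
rewrite [in LHS](coord_basis bmono_basis (memvf h)).
rewrite (reindex (@enum_rank _)) /=; last first.
  by apply: onW_bij; apply: enum_rank_bij.
by apply: eq_bigr => p _; rewrite bmono_nth.
Qed.

Lemma monoc_bmono p q : monoc p (bmono q) = (p == q)%:R.
Proof.
rewrite /monoc bmono_nth coord_free ?(basis_free bmono_basis) //.
by rewrite (inj_eq enum_rank_inj) eq_sym.
Qed.

(** Universal property of the presentation of T(n). The map is defined on the
    monomial basis; it is multiplicative because monomials in [G], [X] obey the
    same straightening rule, and vanish or wrap around at the same exponents, as
    monomials in [g], [x]. *)
Lemma taft_lift (R : algType k) (G X : R) :
    G ^+ n = 1 -> X ^+ n = 0 -> X * G = zeta *: (G * X) ->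
  exists rho : {linear H -> R},
    [/\ forall h h', rho (h * h') = rho h * rho h', rho 1 = 1,
        rho g = G & rho x = X].
Proof.
move=> Gn Xn XG.
pose rho h : R := \sum_p monoc p h *: (G ^+ p.1 * X ^+ p.2).
have rhoL : linear rho.
  move=> a h h'; rewrite /rho scaler_sumr -big_split; apply: eq_bigr => p _ /=.
  by rewrite linearP scalerDl scalerA.
have rho_mono i j : rho (taft_mono i j) = G ^+ i * X ^+ j.
  have [lenj | ltjn] := leqP n j.
    rewrite mono_nilp // -(subnK lenj) exprD Xn !mulr0 /rho big1 // => p _.
    by rewrite linear0 scale0r.
  rewrite -bmono_ord // /rho (bigD1 (ord_n i, ord_n j)) //= big1 => [|p ne_p].
    rewrite monoc_bmono eqxx scale1r addr0 (modn_small ltjn); congr (_ * _).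
    by rewrite [in RHS](divn_eq i n) exprD mulnC exprM Gn expr1n mul1r.
  by rewrite monoc_bmono (negPf ne_p) scale0r.
pose rho' : {linear H -> R} :=
  HB.pack rho (GRing.isLinear.Build k H R *:%R rho rhoL).
exists rho'; split; rewrite /rho' /=.
- move=> h; elim/taft_ind: h => [a h1 h2 IH1 IH2 h' | a b].
    by rewrite mulrDl -scalerAl !rhoL IH1 IH2 mulrDl -scalerAl.
  elim/taft_ind => [c h1 h2 IH1 IH2 | i j].
    by rewrite mulrDr -scalerAr !rhoL IH1 IH2 mulrDr -scalerAr.
  rewrite monoM -[rho _]/(rho' _) linearZ /= !rho_mono.
  by rewrite (skew_monoM _ _ _ _ XG).
- by have := rho_mono 0 0; rewrite /taft_mono !mulr1.
- by have := rho_mono 1 0; rewrite /taft_mono !mulr1.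
- by have := rho_mono 0 1; rewrite /taft_mono !mul1r.
Qed.

End Taft.

(** * Vertex idempotents *)

Section PointwiseOperations.
Variables (k : fieldType) (Q0 : finType).
Implicit Types (p q : vertex_alg k Q0) (s : Q0).

Lemma vaddE p q s : (p + q) s = p s + q s. Proof. exact: ffunE. Qed.
Lemma voppE p s : (- p) s = - p s. Proof. exact: ffunE. Qed.
Lemma vmulE p q s : (p * q) s = p s * q s. Proof. exact: ffunE. Qed.
Lemma vscaleE (a : k) p s : (a *: p) s = a * p s. Proof. exact: ffunE. Qed.

Definition vertexE := (vaddE, voppE, vmulE, vscaleE).

End PointwiseOperations.

Section VertexAlgebra.
Variables (k : fieldType) (m : nat).
Implicit Type p : vertex_alg k 'I_m.+1.

Lemma idemE i (s : 'I_m.+1) : idem k m.+1 i s = (s == inZp i)%:R.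
Proof. by rewrite ffunE -val_eqE /= modn_small. Qed.

Lemma idem_congr i j : i = j %[mod m.+1] -> idem k m.+1 i = idem k m.+1 j.
Proof. by move=> eqij; apply/ffunP => s; rewrite !ffunE eqij. Qed.

Lemma inZpS i : inZp i.+1 = ordS (inZp i : 'I_m.+1).
Proof. by apply: val_inj; rewrite /= -addn1 -(addn1 (i %% _)) modnDml. Qed.

Lemma expr_idem (zeta : k) (s : 'I_m.+1) (i : nat) :
    m.+1.-primitive_root zeta ->
  zeta ^+ s * idem k m.+1 i s = zeta ^+ i * idem k m.+1 i s.
Proof.
move=> zeta_prim; rewrite idemE.
by have [->|_] := altP (s =P inZp i); rewrite ?mulr0 ?prim_expr_mod.
Qed.

Lemma idem_expand p : p = \sum_(s < m.+1) p s *: idem k m.+1 s.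
Proof.
apply/ffunP => t; rewrite sum_ffunE (bigD1 t) //= big1 => [|s ne_st].
  by rewrite addr0 ffunE idemE valZpK eqxx [_ *: _]mulr1.
by rewrite ffunE idemE valZpK eq_sym (negPf ne_st) scaler0.
Qed.

End VertexAlgebra.

(** * Action of a skew primitive element *)

Section Action.
Variables (k : fieldType) (H : hopfAlg k) (Q0 : finType).
Variable act : H -> vertex_alg k Q0 -> vertex_alg k Q0.
Hypothesis actH : hopf_action act.

Lemma act0l p : act 0 p = 0.
Proof.
have := hopf_act_linearl actH p (- 1) 1 1.
by rewrite !scaleN1r !addNr.
Qed.

Lemma act0r h : act h 0 = 0.
Proof.
have := hopf_act_linearr actH h (- 1) 1 1.
by rewrite !scaleN1r !addNr.
Qed.

Lemma act_tens a b p q :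
  tensum (fun h1 h2 : H => act h1 p * act h2 q) (tens a b) = act a p * act b q.
Proof.
rewrite tensum_tens // => c d u v; rewrite (hopf_act_linearl actH);
  apply/ffunP => s; rewrite !ffunE.
  by rewrite mulrDr -[_ *: (_ * _)]/(_ * (_ * _)) mulrCA.
by rewrite mulrDl -[_ *: (_ * _)]/(_ * (_ * _)) mulrA.
Qed.

Lemma act_skew_primitive (g x : H) p q :
    comul x = tens (1 : H) x + tens x g ->
  act x (p * q) = p * act x q + act x p * act g q.
Proof.
move=> dx; rewrite (hopf_act_mul actH) dx linearD /= !act_tens.
by rewrite (hopf_act1 actH).
Qed.

End Action.

(** * Actions extending the rotation of the vertices *)

Section Rotation.
Variables (k : fieldType) (H : hopfAlg k) (zeta : k) (g x : H) (m : nat).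
Variable act : H -> vertex_alg k 'I_m.+1 -> vertex_alg k 'I_m.+1.
Hypothesis rot : extends_rotation g act.
Local Notation e := (idem k m.+1).

Let actH : hopf_action act := rot.1.

HB.instance Definition _ h :=
  GRing.isLinear.Build k _ _ *:%R (act h) (hopf_act_linearr actH h).

Lemma act_rotation p s : act g p (ordS s) = p s.
Proof.
rewrite [in LHS](idem_expand p) linear_sum sum_ffunE (bigD1 s) //= big1.
  rewrite addr0 linearZ ffunE /= rot.2 idemE inZpS valZpK eqxx.
  by rewrite [_ *: _]mulr1.
move=> t ne_ts; rewrite linearZ ffunE /= rot.2 idemE inZpS valZpK.
by rewrite (inj_eq (@ordS_inj _)) eq_sym (negPf ne_ts) scaler0.
Qed.

Hypotheses (comul_x : comul x = tens (1 : H) x + tens x g).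
Hypotheses (counit_x : counit x = 0 :> k) (xg : x * g = zeta *: (g * x)).

Let gamma_ i := act x (e i) (inZp i).

(** [gamma_ i] is the coefficient of x . e_i at its own vertex. Two consecutive
    ones are related by evaluating xg . e_i = zeta gx . e_i at the vertex
    i + 1. *)
Lemma act_x_eigen i : gamma_ i = zeta ^+ i * gamma_ 0.
Proof.
elim: i => [|i IHi]; first by rewrite mul1r.
rewrite exprS -mulrA -IHi /gamma_ -rot.2 -(hopf_actM actH) xg.
have -> : zeta *: (g * x) = zeta *: (g * x) + 0 by rewrite addr0.
rewrite (hopf_act_linearl actH) (hopf_actM actH) inZpS !ffunE act_rotation.
by rewrite act0l // ffunE addr0.
Qed.

(** With a single vertex, the algebra consists of multiples of its unit, which
    [x] annihilates because its counit is 0. *)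
Lemma act_x_rotation_loop p : m = 0%N -> act x p = 0.
Proof.
move=> m0; have -> : p = (p ord0 : k) *: (1 : vertex_alg k 'I_m.+1).
  apply/ffunP => s; rewrite !ffunE [_ *: _]mulr1; congr (p _).
  by apply: val_inj; case: s => -[|s] //=; rewrite m0.
by rewrite linearZ /= (hopf_act_one actH) counit_x scale0r scaler0.
Qed.

(** The skew Leibniz rule applied to e_i e_i = e_i confines x . e_i to the
    vertices i and i + 1, and applied to e_(i+1) e_i = 0 it determines the value
    at i + 1. The second product vanishes only if there are two vertices or
    more, which is the meaning of [0 < m]. *)
Lemma act_x_idem : (0 < m)%N -> forall i,
  act x (e i) = (gamma_ 0 * zeta ^+ i) *: (e i - zeta *: e i.+1).
Proof.
move=> m_gt0 i.
have eM j l : e j * e l = if inZp j == inZp l :> 'I_m.+1 then e j else 0.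
  apply/ffunP => s; rewrite ffunE !idemE.
  have [<-|ne_jl] := altP (inZp j =P inZp l :> 'I_m.+1).
    by rewrite idemE -natrM mulnb andbb.
  rewrite ffunE; have [->|_] := altP (s =P inZp j); last by rewrite mul0r.
  by rewrite mul1r (negPf ne_jl).
have ordS_neq (s : 'I_m.+1) : (ordS s == s) = false.
  apply/negbTE/negP => /eqP /(congr1 val) /=.
  have := ltn_ord s; rewrite ltnS leq_eqVlt => /orP[/eqP->|ltsm].
    by rewrite modnn => m0; rewrite -m0 in m_gt0.
  by rewrite modn_small // => /eqP; rewrite eqn_leq ltnn.
have skew p q := act_skew_primitive actH p q comul_x.
have gammaN : act x (e i) (inZp i.+1) = - gamma_ i.+1.
  apply/eqP; rewrite -addr_eq0; apply/eqP.
  have := skew (e i.+1) (e i); rewrite eM inZpS ordS_neq linear0 rot.2.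
  rewrite -inZpS => /ffunP/(_ (inZp i.+1)); rewrite !vertexE !idemE eqxx.
  by rewrite mul1r mulr1 [X in X = _]ffunE => <-.
have supp s : s != inZp i -> s != inZp i.+1 -> act x (e i) s = 0.
  move=> /negPf ne1 /negPf ne2; have := skew (e i) (e i).
  rewrite eM eqxx rot.2 => /ffunP/(_ s); rewrite !vertexE !idemE ne1 ne2.
  by rewrite mul0r mulr0 addr0.
apply/ffunP => s; rewrite !vertexE !idemE.
have [->|ne1] := altP (s =P inZp i.+1).
  by rewrite inZpS ordS_neq -inZpS gammaN act_x_eigen exprS sub0r mulr1; ring.
have [->|ne0] := altP (s =P inZp i); last by rewrite supp // mulr0 subrr mulr0.
by rewrite -/(gamma_ i) act_x_eigen mulr0 subr0 mulr1 mulrC.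
Qed.

(** Going once around the cycle brings [gamma_ 0] back to itself, but multiplied
    by zeta to the number of vertices. *)
Lemma act_x_eq0 p : zeta ^+ m.+1 != 1 -> act x p = 0.
Proof.
move=> zetam; have [m0 | m_gt0] := posnP m; first exact: act_x_rotation_loop.
have gamma0 : gamma_ 0 = 0.
  have : gamma_ m.+1 = gamma_ 0.
    rewrite /gamma_ (@idem_congr k m m.+1 0) ?modnn //; congr (act _ _ _).
    by apply: val_inj; rewrite /= modnn.
  rewrite act_x_eigen => /eqP; rewrite -subr_eq0 -[X in _ - X]mul1r -mulrBl.
  by rewrite mulf_eq0 subr_eq0 (negPf zetam) => /eqP.
rewrite (idem_expand p) linear_sum big1 // => s _.
by rewrite linearZ /= act_x_idem // gamma0 mul0r scale0r scaler0.
Qed.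

End Rotation.

(** * Construction of the action *)

Lemma tensum_exchange (k : fieldType) (U V U' V' : vectType k)
    (W : lmodType k) (f : U -> V -> U' -> V' -> W) s t :
  tensum (fun a b => tensum (f a b) t) s
  = tensum (fun c d => tensum (fun a b => f a b c d) s) t.
Proof.
rewrite /tensum !pair_bigA /=.
under eq_bigr do rewrite pair_bigA scaler_sumr.
under [RHS]eq_bigr do rewrite pair_bigA scaler_sumr.
rewrite exchange_big; apply: eq_bigr => i _; apply: eq_bigr => j _.
by rewrite !scalerA mulrC.
Qed.

Lemma prim_neq0 (k : fieldType) (n : nat) (zeta : k) :
  n.-primitive_root zeta -> zeta != 0.
Proof.
move=> zeta_prim; apply/eqP => z0; have /eqP := prim_expr_order zeta_prim.
by rewrite z0 expr0n gtn_eqF ?(prim_order_gt0 zeta_prim) // eq_sym oner_eq0.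
Qed.

(** Moving all factors [U] to the left turns the n-th power into a multiple of
    [U ^+ n] times the product of all [G - zeta ^+ l], that is, [G ^+ n - 1]. *)
Lemma skew_expr_eq0 (k : fieldType) (n : nat) (zeta : k) (R : algType k)
    (G U : R) :
    n.-primitive_root zeta -> G ^+ n = 1 -> U * G = zeta *: (G * U) ->
  (U * (1 - G)) ^+ n = 0.
Proof.
move=> zeta_prim Gn UG.
have zetaj_neq0 j : zeta ^+ j != 0 by rewrite expf_neq0 ?(prim_neq0 zeta_prim).
pose P j : {poly k} := \prod_(0 <= l < j) ('X - (zeta ^+ l)%:P).
have UGj j : exists c, (U * (1 - G)) ^+ j = c *: (U ^+ j * horner_alg G (P j)).
  elim: j => [|j [c IHj]].
    by exists 1; rewrite /P big_nil rmorph1 mulr1 scale1r.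
  exists (- c * (zeta ^+ j)^-1).
  have GU : (1 - G) * U ^+ j
      = - (zeta ^+ j)^-1 *: (U ^+ j * (G - (zeta ^+ j)%:A)).
    rewrite mulrBl mul1r mulrBr (@expr_skew_comm k zeta R G U 1 j UG) mul1n.
    rewrite -scalerAr mulr1 scalerBr scaleNr scalerA mulVf //.
    by rewrite scaleNr scalerA mulVf // !scale1r opprK addrC.
  rewrite exprS IHj -scalerAr mulrA -(mulrA U) GU -!scalerAr -!scalerAl.
  rewrite scalerA mulrN mulNr exprS -!mulrA; congr (_ *: (_ * (_ * _))).
  rewrite /P big_nat_recr //= mulrC rmorphM rmorphB /=.
  by rewrite horner_algX horner_algC.
have [c ->] := UGj n; rewrite /P factor_Xn_sub_1 // rmorphB rmorphXn rmorph1 /=.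
by rewrite horner_algX Gn subrr mulr0 scaler0.
Qed.

Section TaftAction.
Variables (k : fieldType) (n : nat) (zeta : k).
Hypothesis n_ge2 : (2 <= n)%N.
Variables (H : hopfAlg k) (g x : H).
Hypothesis taftH : is_taft n zeta g x.

(** The elements of H that satisfy the two module algebra axioms are closed
    under products and linear combinations, so the generators suffice. *)
Lemma taft_hopf_action (Q0 : finType)
    (act : H -> vertex_alg k Q0 -> vertex_alg k Q0) :
    (forall p, linear (act^~ p)) -> (forall h, linear (act h)) ->
    (forall p, act 1 p = p) ->
    (forall h h' p, act (h * h') p = act h (act h' p)) ->
    (forall p q, act g (p * q) = act g p * act g q) ->
    (forall p q, act x (p * q) = p * act x q + act x p * act g q) ->
    act g 1 = 1 -> act x 1 = 0 ->
  hopf_action act.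
Proof.
move=> lin1 lin2 act1 actM actg actx actg1 actx1.
pose F p q (h1 h2 : H) := act h1 p * act h2 q.
have FP p q :
    (forall u', linear (F p q u')) * (forall v', linear ((F p q)^~ v')).
  split=> c d u v; rewrite /F lin1; apply/ffunP => s; rewrite !ffunE.
    by rewrite mulrDr -[_ *: (_ * _)]/(_ * (_ * _)) mulrCA.
  by rewrite mulrDl -[_ *: (_ * _)]/(_ * (_ * _)) mulrA.
have Ftens p q a b : tensum (F p q) (tens a b) = act a p * act b q.
  by rewrite tensum_tens //; have [] := FP p q.
pose P h := (forall p q, act h (p * q) = tensum (F p q) (comul h))
            /\ act h 1 = counit h *: (1 : vertex_alg k Q0).
suff Pall : forall h, P h.
  by split=> // [h p q | h]; have [] := Pall h.
have PM h h' : P h -> P h' -> P (h * h').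
  move=> [hM h1] [h'M h'1].
  pose actL : {linear vertex_alg k Q0 -> vertex_alg k Q0} :=
    HB.pack (act h) (GRing.isLinear.Build k _ _ *:%R (act h) (lin2 h)).
  split=> [p q |]; rewrite actM.
    rewrite h'M -[act h _]/(actL _) linear_tensum comulM linear_tensum.
    under [RHS]eq_tensum do rewrite linear_tensum.
    rewrite tensum_exchange; apply: eq_tensum => c d /=; rewrite hM.
    by apply: eq_tensum => a b; rewrite Ftens !actM.
  rewrite h'1 -[act h _]/(actL _) linearZ /= h1 rmorphM /= scalerA.
  by rewrite [X in X *: _]mulrC.
have P1 : P 1.
  by split=> [p q |]; rewrite ?(comul1 H) ?Ftens !act1 ?rmorph1 ?scale1r.
have PX h j : P h -> P (h ^+ j).
  by move=> Ph; elim: j => // j IHj; rewrite exprS; apply: PM.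
elim/(taft_ind n_ge2 taftH) => [a h h' [hM h1] [h'M h'1] | i j].
  split=> [p q |].
    by rewrite lin1 hM h'M linearP linearP.
  by rewrite lin1 h1 h'1 linearP scalerDl scalerA.
apply: PM; apply: PX.
  by split=> [p q |]; rewrite ?actg ?(taft_comul_g taftH) ?Ftens //
     (taft_counit_g taftH) scale1r.
split=> [p q |]; last by rewrite (taft_counit_x taftH) scale0r.
by rewrite actx (taft_comul_x taftH) linearD /= !Ftens act1.
Qed.

End TaftAction.

(** With [u] the function [s |-> gamma * zeta ^+ s] on the vertices, the required
    formula reads x . p = u (p - g . p), which does satisfy the skew Leibniz
    rule. The operators of [g] and [x] are written as matrices [G] and
    [gamma *: (U * (1 - G))]; their Taft relations reduce to [G ^+ n = 1] and
    [U * G = zeta *: (G * U)]. *)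
Lemma taft_action_exists (k : fieldType) (m : nat) (zeta : k) (H : hopfAlg k)
    (g x : H) (gamma : k) :
    (1 < m.+1)%N -> m.+1.-primitive_root zeta -> is_taft m.+1 zeta g x ->
  exists act : H -> vertex_alg k 'I_m.+1 -> vertex_alg k 'I_m.+1,
    extends_rotation g act /\
    forall i : nat, act x (idem k m.+1 i)
      = (gamma * zeta ^+ i) *: (idem k m.+1 i - zeta *: idem k m.+1 i.+1).
Proof.
move=> n_ge2 zeta_prim taftH.
have zeta_mod (i : nat) : zeta ^+ (inZp i : 'I_m.+1) = zeta ^+ i.
  exact: prim_expr_mod.
pose G : 'M[k]_m.+1 := \matrix_(i, j) (i == ordS j)%:R.
pose U : 'M[k]_m.+1 := diag_mx (\row_j zeta ^+ j).
pose X := gamma *: (U * (1 - G)).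
have Gexp l i j : (G ^+ l) i j = (i == inZp (j + l))%:R.
  elim: l i j => [|l IHl] i j; first by rewrite mxE addn0 valZpK.
  rewrite exprS mxE (bigD1 (inZp (j + l))) //= big1 => [|t ne_t].
    by rewrite IHl mxE eqxx mulr1 addr0 addnS inZpS.
  by rewrite IHl (negPf ne_t) mulr0.
have Gn : G ^+ m.+1 = 1.
  apply/matrixP => i j; rewrite Gexp mxE; congr (_ == _)%:R.
  by apply: val_inj; rewrite /= modnDr modn_small.
have UG : U * G = zeta *: (G * U).
  apply/matrixP => i j.
  rewrite [in RHS]mxE [U * G]mul_diag_mx [G * U]mul_mx_diag.
  rewrite !mxE; have [->|_] := altP (i =P ordS j); last first.
    by rewrite mulr0 mul0r mulr0.
  by rewrite mulr1 mul1r -exprS -(zeta_mod j.+1) inZpS valZpK.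
have Xn : X ^+ m.+1 = 0 by rewrite exprZn (skew_expr_eq0 zeta_prim) // scaler0.
have XG : X * G = zeta *: (G * X).
  rewrite /X -scalerAl -scalerAr scalerA mulrC -scalerA; congr (_ *: _).
  by rewrite -mulrA mulrBl mul1r -{1}[G]mulr1 -mulrBr mulrA UG -scalerAl mulrA.
have [rho [rhoM rho1 rhog rhox]] := taft_lift n_ge2 taftH Gn Xn XG.
pose act (h : H) (p : vertex_alg k 'I_m.+1) : vertex_alg k 'I_m.+1 :=
  [ffun i => \sum_j rho h i j * p j].
have actg p s : act g p s = p (ord_pred s).
  rewrite ffunE rhog (bigD1 (ord_pred s)) //= big1 => [|t ne_ts].
    by rewrite mxE ord_predK eqxx mul1r addr0.
  rewrite mxE -(can2_eq (@ord_predK _) (@ordSK _)) eq_sym.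
  by rewrite (negPf ne_ts) mul0r.
have actx p s : act x p s = gamma * zeta ^+ s * (p s - act g p s).
  rewrite !ffunE rhox rhog.
  have -> : p s = \sum_j (1%:M : 'M[k]_m.+1) s j * p j.
    rewrite (bigD1 s) //= big1 => [|t ne_ts].
      by rewrite mxE eqxx mul1r addr0.
    by rewrite mxE eq_sym (negPf ne_ts) mul0r.
  rewrite -sumrB mulr_sumr; apply: eq_bigr => j _.
  by rewrite -mulrBl mulrA mxE [U * _]mul_diag_mx !mxE mulrA.
have actg_idem i : act g (idem k m.+1 i) = idem k m.+1 i.+1.
  apply/ffunP => s; rewrite actg !idemE inZpS.
  by rewrite (can2_eq (@ord_predK _) (@ordSK _)).
exists act; split; first split=> //.
  apply: (taft_hopf_action n_ge2 taftH).
  - move=> p a h h'; apply/ffunP => s; rewrite !ffunE linearP.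
    rewrite [X in _ = X + _]mulr_sumr -big_split; apply: eq_bigr => j _.
    by rewrite !mxE mulrDl mulrA.
  - move=> h a p q; apply/ffunP => s; rewrite !ffunE.
    rewrite [X in _ = X + _]mulr_sumr -big_split; apply: eq_bigr => j _.
    by rewrite !ffunE mulrDr -[a *: _]/(a * _) mulrCA.
  - move=> p; apply/ffunP => s.
    rewrite !ffunE rho1 (bigD1 s) //= big1 => [|t ne_ts].
      by rewrite mxE eqxx mul1r addr0.
    by rewrite mxE eq_sym (negPf ne_ts) mul0r.
  - move=> h h' p; apply/ffunP => s; rewrite !ffunE rhoM.
    under eq_bigr do rewrite mxE mulr_suml.
    rewrite exchange_big; apply: eq_bigr => j _; rewrite ffunE mulr_sumr.
    by apply: eq_bigr => t _; rewrite mulrA.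
  - by move=> p q; apply/ffunP => s; rewrite [in RHS]ffunE !actg ffunE.
  - move=> p q; apply/ffunP => s; rewrite actx [in RHS]ffunE.
    rewrite [X in _ = X + _]ffunE [X in _ = _ + X]ffunE !actx !actg !ffunE.
    by ring.
  - by apply/ffunP => s; rewrite actg !ffunE.
  by apply/ffunP => s; rewrite actx actg !ffunE subrr mulr0.
move=> i; apply/ffunP => s; rewrite actx actg_idem.
by rewrite !vertexE -mulrA mulrBr !expr_idem // exprS; ring.
Qed.

(** * Comultiplication of monomials and the Hopf ideal generated by x *)

Section TaftIdeal.
Variables (k : fieldType) (n : nat) (zeta : k).
Hypothesis n_ge2 : (2 <= n)%N.
Variables (H : hopfAlg k) (g x : H).
Hypothesis taftH : is_taft n zeta g x.
Local Notation mono := (taft_mono g x).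

(** Gaussian binomial coefficients at [zeta], given by the Pascal rule: as
    [zeta] is a root of unity, the quotient formula would divide by zero. *)
Fixpoint qbin (j l : nat) : k :=
  match j, l with
  | _, 0 => 1
  | 0, _.+1 => 0
  | j'.+1, l'.+1 => qbin j' l'.+1 + zeta ^+ (j' - l') * qbin j' l'
  end.

Lemma qbin0 j : qbin j 0 = 1. Proof. by case: j. Qed.

Lemma qbin_small j l : (j < l)%N -> qbin j l = 0.
Proof.
elim: j l => [|j IHj] [|l] //= ltjl.
by rewrite !IHj ?mulr0 ?addr0 // ltnW.
Qed.

Lemma qbinn j : qbin j j = 1.
Proof.
by elim: j => //= j IHj; rewrite qbin_small // subnn mul1r IHj add0r.
Qed.

Lemma mono_mulx i j : mono i j * x = mono i j.+1.
Proof. by rewrite /taft_mono exprSr mulrA. Qed.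

Lemma mono_mulg i j : mono i j * g = zeta ^+ j *: mono i.+1 j.
Proof.
by rewrite -{2}(mono10 g x) (monoM taftH) mul1n addn0 addn1.
Qed.

Lemma comul_mono i j :
  comul (mono i j)
  = \sum_(l < j.+1) qbin j l *: tens (mono i l) (mono (i + l) (j - l)).
Proof.
elim: j => [|j IHj].
  rewrite big_ord1 scale1r /taft_mono !mulr1 addn0.
  elim: i => [|i IHi]; first exact: comul1.
  by rewrite exprSr comul_mul IHi (taft_comul_g taftH) tens_mul_tens.
rewrite -mono_mulx comul_mul IHj (taft_comul_x taftH) /tens_mul linear_sum /=.
pose T l := tens (mono i l) (mono (i + l) (j.+1 - l)).
have stepE (l : 'I_j.+1) :
    tensum (fun a b : H => tensum (fun c d : H => tens (a * c : H) (b * d : H))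
       (tens (1 : H) x + tens x g))
      (qbin j l *: tens (mono i l) (mono (i + l) (j - l)))
    = qbin j l *: T l + (zeta ^+ (j - l) * qbin j l) *: T l.+1.
  rewrite linearZ /= -[tensum _ _]/(tens_mul _ _) linearD /= !tens_mul_tens.
  rewrite mulr1 !mono_mulx mono_mulg linearZ /= scalerDr scalerA mulrC.
  by rewrite /T addnS subSS subSn // -ltnS.
under eq_bigr => l _ do rewrite stepE.
rewrite big_split /= [RHS]big_ord_recl /=.
rewrite -[in RHS](qbin0 j) -/(T 0).
under [X in _ = _ + X]eq_bigr => l _ do rewrite scalerDl -/(T l.+1).
rewrite big_split addrA /=; congr (_ + _).
rewrite -(big_ord_recl j.+1 (fun l : 'I_j.+2 => qbin j l *: T l)).
by rewrite [RHS]big_ord_recr /= (@qbin_small j j.+1) // scale0r addr0.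
Qed.

Lemma counit_mono i j : counit (mono i j) = (j == 0%N)%:R :> k.
Proof.
rewrite rmorphM !rmorphXn /= (taft_counit_g taftH) (taft_counit_x taftH).
by rewrite expr1n mul1r expr0n.
Qed.

Definition x_ideal : {vspace H} := limg (amulr x).

Lemma x_idealP y : reflect (exists h, y = h * x) (y \in x_ideal).
Proof.
apply: (iffP memv_imgP) => [[h _ ->] | [h ->]].
  by exists h; rewrite lfunE.
by exists h; rewrite ?memvf ?lfunE.
Qed.

Lemma x_ideal_x : x \in x_ideal.
Proof. by apply/x_idealP; exists 1; rewrite mul1r. Qed.

Lemma x_ideal_mono i j : (0 < j)%N -> mono i j \in x_ideal.
Proof.
by case: j => // j _; apply/x_idealP; exists (mono i j); rewrite mono_mulx.
Qed.

Lemma x_ideal_mull h y : y \in x_ideal -> h * y \in x_ideal.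
Proof.
by case/x_idealP=> c ->; apply/x_idealP; exists (h * c); rewrite mulrA.
Qed.

Lemma x_ideal_mulr h y : y \in x_ideal -> y * h \in x_ideal.
Proof.
case/x_idealP=> c ->; rewrite -mulrA; apply: x_ideal_mull.
elim/(taft_ind n_ge2 taftH): h => [a h h' hI h'I | i j].
  by rewrite mulrDr -scalerAr memvD ?memvZ.
by rewrite -{1}(mono01 g x) (monoM taftH) memvZ // x_ideal_mono.
Qed.

(** In the antipode identity S(h_1) h_2 = counit(h) for h = g^i x^j, one term is
    S(g^i x^j) g^(i+j), and in all others the right factor contains [x]; as [g]
    is invertible, this places S(g^i x^j) in the ideal without knowing that S
    reverses products. *)
Lemma antipode_mono i j : (0 < j)%N -> antipode (mono i j) \in x_ideal.
Proof.
move=> j_gt0; have := antipodel (mono i j).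
rewrite counit_mono gtn_eqF // scale0r comul_mono linear_sum big_ord_recr /=.
have tensumE a b : tensum (fun c d : H => antipode c * d) (tens (a : H) (b : H))
    = antipode a * b.
  rewrite tensum_tens // => u c v w; first by rewrite mulrDr scalerAr.
  by rewrite linearP mulrDl scalerAl.
rewrite linearZ /= tensumE qbinn scale1r subnn => /eqP.
rewrite addrC addr_eq0 => /eqP SE.
have {SE} : antipode (mono i j) * mono (i + j) 0 \in x_ideal.
  rewrite SE memvN; apply: memv_suml => l _; rewrite linearZ memvZ //= tensumE.
  by rewrite x_ideal_mull // x_ideal_mono // subn_gt0.
(* Multiply by the inverse of g^(i+j). *)
move/(x_ideal_mulr (mono (n.-1 * (i + j)) 0)); rewrite -mulrA (monoM taftH).
rewrite muln0 scale1r -mulSn prednK ?(ltnW n_ge2) // /taft_mono exprM.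
by rewrite (taft_gn taftH) expr1n !mulr1.
Qed.

Lemma x_hopf_ideal : hopf_ideal x_ideal.
Proof.
split; [exact: x_ideal_mull | exact: x_ideal_mulr | | |].
- move=> _ /x_idealP[h ->]; rewrite comul_mul (taft_comul_x taftH).
  rewrite linearD /= memvD //.
    rewrite tens_mul_tensr; apply: (subvP (addvSr _ _)).
    apply: mem_tensum => a b.
    by rewrite mem_tensv ?memvf // x_ideal_mull // x_ideal_x.
  rewrite tens_mul_tensr; apply: (subvP (addvSl _ _)); apply: mem_tensum => a b.
  by rewrite mem_tensv ?memvf // x_ideal_mull // x_ideal_x.
- by move=> _ /x_idealP[h ->]; rewrite rmorphM /= (taft_counit_x taftH) mulr0.
move=> _ /x_idealP[h ->].
elim/(taft_ind n_ge2 taftH): h => [a h h' hI h'I | i j].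
  by rewrite mulrDl -scalerAl linearP memvD ?memvZ.
by rewrite mono_mulx antipode_mono.
Qed.

Lemma x_neq0 : x != 0.
Proof.
pose p := (ord_n n_ge2 0, ord_n n_ge2 1).
have xE : bmono g x p = x by rewrite (bmono_ord n_ge2 taftH) // mono01.
apply/eqP => x0; have := monoc_bmono n_ge2 taftH p p.
by rewrite xE x0 linear0 eqxx => /esym/eqP; rewrite oner_eq0.
Qed.

(** If [x] acted by zero, so would the nonzero Hopf ideal that it generates. *)
Lemma inner_faithful_x_neq0 (Q0 : finType)
    (act : H -> vertex_alg k Q0 -> vertex_alg k Q0) :
  hopf_action act -> inner_faithful act -> exists p, act x p <> 0.
Proof.
move=> actH faith.
have [|h [p [/x_idealP[c ->] cx_neq0]]] := faith _ x_hopf_ideal.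
  move=> I0; have /eqP[] := x_neq0; apply/eqP; rewrite -memv0 -I0.
  exact: x_ideal_x.
exists p => xp0; apply: cx_neq0.
by rewrite (hopf_actM actH) xp0 (act0r actH).
Qed.

End TaftIdeal.

(** * Inner faithfulness *)

Section InnerFaithful.
Variables (k : fieldType) (m : nat) (zeta : k).
Hypotheses (n_ge2 : (1 < m.+1)%N) (zeta_prim : m.+1.-primitive_root zeta).
Variables (H : hopfAlg k) (g x : H).
Hypothesis taftH : is_taft m.+1 zeta g x.
Variable act : H -> vertex_alg k 'I_m.+1 -> vertex_alg k 'I_m.+1.
Hypothesis rot : extends_rotation g act.
Hypothesis act_x : forall i : nat, act x (idem k m.+1 i)
  = zeta ^+ i *: (idem k m.+1 i - zeta *: idem k m.+1 i.+1).
Local Notation mono := (taft_mono g x).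
Local Notation w := (zeta^-1).

Let actH : hopf_action act := rot.1.

HB.instance Definition _ h :=
  GRing.isLinear.Build k _ _ *:%R (act h) (hopf_act_linearr actH h).

(** The powers of the function [s |-> zeta ^+ s]: they are eigenvectors of [g],
    and [x] sends each one to a multiple of the next. *)
Definition upow (b : nat) : vertex_alg k 'I_m.+1 :=
  [ffun s : 'I_m.+1 => zeta ^+ (b * s)].

(** Discrete Fourier transform: n times the coordinate on [upow a]. *)
Definition fcoef (a : nat) (p : vertex_alg k 'I_m.+1) : k^o :=
  \sum_(s < m.+1) w ^+ (a * s) * p s.

Lemma fcoef_linear a : linear (fcoef a).
Proof.
move=> c p q; rewrite /fcoef scaler_sumr -big_split; apply: eq_bigr => s _ /=.
by rewrite !ffunE mulrDr -[c *: p s]/(c * p s) mulrCA.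
Qed.

HB.instance Definition _ a :=
  GRing.isLinear.Build k _ _ *:%R (fcoef a) (fcoef_linear a).

Lemma fcoefZ a c p : fcoef a (c *: p) = c * fcoef a p.
Proof. exact: linearZ. Qed.

Lemma fcoef_upow a b :
  fcoef a (upow b) = if a == b %[mod m.+1] then m.+1%:R else 0.
Proof.
have -> : fcoef a (upow b) = \sum_(s < m.+1) (w ^+ a * zeta ^+ b) ^+ s.
  by apply: eq_bigr => s _; rewrite ffunE exprMn -!exprM.
have z_eq1 : (w ^+ a * zeta ^+ b == 1) = (a == b %[mod m.+1]).
  have zetaa : zeta ^+ a != 0 by rewrite expf_neq0 // (prim_neq0 zeta_prim).
  rewrite -(eq_prim_root_expr zeta_prim) -(inj_eq (mulfI zetaa)) mulr1 mulrA.
  by rewrite exprVn mulfV // mul1r eq_sym.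
rewrite -z_eq1; have [->|z_neq1] := altP eqP.
  by under eq_bigr do rewrite expr1n; rewrite sumr_const card_ord.
apply: (mulfI (x := w ^+ a * zeta ^+ b - 1)); first by rewrite subr_eq0.
rewrite -subrX1 mulr0 exprMn -!exprM !(mulnC _ m.+1) !exprM exprVn.
by rewrite (prim_expr_order zeta_prim) invr1 !expr1n mulr1 subrr.
Qed.

Lemma act_g_upow b : act g (upow b) = w ^+ b *: upow b.
Proof.
apply/ffunP => s; rewrite -[s]ord_predK (act_rotation rot) !ffunE.
set t := ord_pred s; rewrite -[RHS]/(w ^+ b * _).
have -> : zeta ^+ (b * ordS t) = zeta ^+ b * zeta ^+ (b * t).
  rewrite -exprD -mulnS; apply/eqP; rewrite (eq_prim_root_expr zeta_prim).
  by rewrite modnMmr.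
by rewrite exprVn mulKf // expf_neq0 // (prim_neq0 zeta_prim).
Qed.

Lemma act_x_val p s : act x p s = zeta ^+ s * (p s - act g p s).
Proof.
rewrite (idem_expand p) !linear_sum !sum_ffunE -sumrB mulr_sumr.
apply: eq_bigr => t _; rewrite !linearZ /= act_x rot.2.
rewrite !vertexE -mulrBr [RHS]mulrCA; congr (p t * _).
by rewrite !mulrBr !expr_idem // exprS; ring.
Qed.

Lemma act_x_upow b : act x (upow b) = (1 - w ^+ b) *: upow b.+1.
Proof.
apply/ffunP => s; rewrite act_x_val act_g_upow !vertexE !ffunE mulSn exprD.
by ring.
Qed.

Definition upow_coef b l := \prod_(t < l) (1 - w ^+ (b + t)).

Lemma act_mono_upow i l b :
  act (mono i l) (upow b)
  = (w ^+ (i * (b + l)) * upow_coef b l) *: upow (b + l).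
Proof.
elim: i => [|i IHi].
  rewrite mul0n mul1r /taft_mono mul1r; elim: l => [|l IHl].
    by rewrite (hopf_act1 actH) /upow_coef big_ord0 scale1r addn0.
  rewrite exprS (hopf_actM actH) IHl linearZ /= act_x_upow scalerA addnS.
  by rewrite /upow_coef big_ord_recr.
have -> : mono i.+1 l = g * mono i l by rewrite /taft_mono exprS mulrA.
rewrite (hopf_actM actH) IHi linearZ /= act_g_upow scalerA mulSn.
by rewrite [in RHS]exprD -mulrA mulrC.
Qed.

(** The contraction of the comultiplication with the matrix coefficient of
    [upow a]. It maps a Hopf ideal that acts by zero into itself, and it scales
    g^i x^j by n zeta^(-ia). Evaluating all twists at one vector thus recovers
    coefficients that the action on this vector only shows in sum. *)
Definition twist a (h : H) : H :=
  tensum (fun b c : H => fcoef a (act b (upow a)) *: c) (comul h).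

Let twist_fun_linear a :
  (forall b : H, linear (fun c : H => fcoef a (act b (upow a)) *: c))
  * (forall c : H, linear (fun b : H => fcoef a (act b (upow a)) *: c)).
Proof.
split=> [b d u v | c d u v]; first by rewrite scalerDr !scalerA mulrC.
by rewrite (hopf_act_linearl actH) linearP scalerDl scalerA.
Qed.

Lemma twist_linear a : linear (twist a).
Proof. by move=> d u v; rewrite /twist linearP linearP. Qed.

HB.instance Definition _ a :=
  GRing.isLinear.Build k H H *:%R (twist a) (twist_linear a).

(** In the comultiplication of g^i x^j, the term with x^l on the left shifts
    [upow a] to [upow (a + l)], which for [0 < l < n] has no component along
    [upow a]; only the term with [l = 0] survives. *)
Lemma twist_mono a i j : (j < m.+1)%N ->
  twist a (mono i j) = (m.+1%:R * w ^+ (i * a)) *: mono i j.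
Proof.
move=> ltj; rewrite /twist (comul_mono taftH) linear_sum big_ord_recl /= big1.
  rewrite addr0 qbin0 scale1r tensum_tens; try by have [] := twist_fun_linear a.
  rewrite act_mono_upow fcoefZ fcoef_upow !addn0 eqxx subn0.
  by rewrite /upow_coef big_ord0 mulr1 [X in X *: _]mulrC.
move=> l _; rewrite linearZ /= tensum_tens;
  try by have [] := twist_fun_linear a.
rewrite act_mono_upow fcoefZ fcoef_upow.
have -> : (a == a + bump 0 l %[mod m.+1]) = false.
  rewrite -{1}[a]addn0 eqn_modDl mod0n modn_small //.
  by rewrite (leq_ltn_trans _ ltj) // ltn_ord.
by rewrite /= mulr0 scale0r scaler0.
Qed.

Lemma twist_ideal (I : {vspace H}) a h :
    hopf_ideal I -> (forall y p, y \in I -> act y p = 0) ->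
  h \in I -> twist a h \in I.
Proof.
move=> hopfI actI hI; rewrite /twist.
have /memv_addP[s sI [t tI ->]] := hopf_ideal_comul hopfI hI.
rewrite linearD memvD //=.
  apply: (tensum_tensv _ _ _ sI); try by have [] := twist_fun_linear a.
  by move=> u v uI _; rewrite actI // linear0 scale0r mem0v.
apply: (tensum_tensv _ _ _ tI); try by have [] := twist_fun_linear a.
by move=> u v _ vI; rewrite memvZ.
Qed.

Definition probe a b (h : H) : k^o := fcoef b (act (twist a h) (upow 1)).

Lemma probe_linear a b : linear (probe a b).
Proof.
by move=> c u v; rewrite /probe linearP (hopf_act_linearl actH) linearP.
Qed.

HB.instance Definition _ a b :=
  GRing.isLinear.Build k H k^o *:%R (probe a b) (probe_linear a b).

Lemma probe_mono a (j l : 'I_m.+1) i :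
  probe a j.+1 (mono i l)
  = if j == l
    then m.+1%:R * m.+1%:R * upow_coef 1 j * w ^+ (a + j.+1) ^+ i else 0.
Proof.
rewrite /probe twist_mono // -[_ *: mono _ _]addr0 (hopf_act_linearl actH).
rewrite (act0l actH) addr0 fcoefZ act_mono_upow fcoefZ fcoef_upow.
rewrite add1n -[j.+1]addn1 -[l.+1]addn1 eqn_modDr !modn_small // -val_eqE.
have [/val_inj -> | _] := altP eqP; last by rewrite /= !mulr0.
rewrite -exprM [((a + _) * i)%N]mulnC [(i * (a + _))%N]mulnDr.
by rewrite [w ^+ (i * a + _)]exprD; ring.
Qed.

Lemma upow_coef1_neq0 j : (j < m.+1)%N -> upow_coef 1 j != 0.
Proof.
move=> ltj; apply/prodf_neq0 => t _; rewrite subr_eq0 eq_sym exprVn invr_eq1.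
rewrite -(expr0 zeta) (eq_prim_root_expr zeta_prim) mod0n add1n modn_small //.
by rewrite (leq_ltn_trans _ ltj).
Qed.

(** Let [h] in [I] have coefficients c_ij on g^i x^j. For every [a] the twisted
    element still lies in [I] and kills [upow 1]; as x^j . [upow 1] is a nonzero
    multiple of [upow j.+1], comparing components gives
    sum_i c_ij w^((a + j + 1) i) = 0. Thus for fixed [j] the polynomial with
    coefficients c_ij has degree less than n and n distinct roots. *)
Lemma hopf_ideal_act0 (I : {vspace H}) :
  hopf_ideal I -> (forall y p, y \in I -> act y p = 0) -> I = 0%VS.
Proof.
move=> hopfI actI; apply/eqP; rewrite -subv0; apply/subvP => h hI.
rewrite memv0 (mono_expand n_ge2 taftH h); apply/eqP/big1 => -[i0 j] _.
suff -> : monoc g x (i0, j) h = 0 by rewrite scale0r.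
pose c i := monoc g x (i, j) h : k.
pose P : {poly k} := \poly_(i < m.+1) c (inZp i).
suff P0 : P = 0.
  have := congr1 (fun q : {poly k} => q`_i0) P0.
  by rewrite coef_poly ltn_ord coef0 /c valZpK.
pose rs := [seq w ^+ (a + j.+1) | a <- iota 0 m.+1].
apply: (@roots_geq_poly_eq0 _ _ rs); last first.
- by rewrite size_map size_iota size_poly.
- rewrite map_inj_in_uniq ?iota_uniq // => a b.
  rewrite !mem_iota !add0n /= => lta ltb; rewrite !exprVn => /invr_inj/eqP.
  by rewrite (eq_prim_root_expr zeta_prim) eqn_modDr !modn_small // => /eqP.
apply/allP => _ /mapP[a _ ->]; apply/rootP; rewrite horner_poly.
have nR_neq0 := prim_root_natf_neq0 zeta_prim.
have K_neq0 : m.+1%:R * m.+1%:R * upow_coef 1 j != 0.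
  by rewrite !mulf_neq0 // upow_coef1_neq0.
apply: (mulfI K_neq0); rewrite mulr0 mulr_sumr.
have probe0 : probe a j.+1 h = 0 by rewrite /probe actI ?linear0 // twist_ideal.
rewrite -[RHS]probe0 [in RHS](mono_expand n_ge2 taftH h) linear_sum.
pose F (i l : 'I_m.+1) := probe a j.+1 (monoc g x (i, l) h *: mono i l).
rewrite (eq_bigr (fun p => F p.1 p.2)) => [|[i l] _ //].
rewrite -(pair_bigA _ F) /=; apply: eq_bigr => i _; rewrite (bigD1 j) //=.
rewrite big1 => [|l ne_lj]; rewrite /F linearZ /= probe_mono.
  by rewrite addr0 eqxx /c valZpK mulrCA.
by rewrite eq_sym (negPf ne_lj) scaler0.
Qed.

(** Whether [I] acts by zero can be tested on a basis of [I] and the vertex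
    idempotents; this finite test provides the explicit witness. *)
Lemma taft_inner_faithful : inner_faithful act.
Proof.
move=> I hopfI I_neq0.
have [/existsP[a /existsP[i /eqP neq0]] | ] :=
  boolP [exists a : 'I_(\dim I), [exists i : 'I_m.+1,
     act (vbasis I)`_a (idem k m.+1 i) != 0]].
  exists (vbasis I)`_a, (idem k m.+1 i); split=> //.
  by apply: vbasis_mem; rewrite mem_nth ?size_tuple.
move=> /existsPn noact; case: I_neq0; apply: hopf_ideal_act0 => // y p yI.
rewrite (idem_expand p) linear_sum big1 // => i _; rewrite linearZ /=.
rewrite (coord_vbasis yI).
suff -> :
    act (\sum_a coord (vbasis I) a y *: (vbasis I)`_a) (idem k m.+1 i) = 0.
  by rewrite scaler0.
elim/big_rec: _ => [|a z _ IHz]; first exact: act0l.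
rewrite (hopf_act_linearl actH) IHz addr0.
by have /existsPn/(_ i) := noact a; rewrite negbK => /eqP ->; rewrite scaler0.
Qed.

End InnerFaithful.

(** * The theorem *)

Theorem proposition3p5 (k : fieldType) (n : nat) (zeta : k)
    (n_ge2 : (2 <= n)%N) (zeta_prim : n.-primitive_root zeta)
    (H : hopfAlg k) (g x : H) (taftH : is_taft n zeta g x)
    (m : nat) (m_dvd_n : (m %| n)%N) :
  [/\ (m < n)%N ->
        forall act : H -> vertex_alg k 'I_m -> vertex_alg k 'I_m,
          extends_rotation g act -> forall p, act x p = 0,
      m = n ->
        (forall act : H -> vertex_alg k 'I_m -> vertex_alg k 'I_m,
           extends_rotation g act ->
           exists gamma : k, forall i : nat,
             act x (idem k m i)
             = (gamma * zeta ^+ i) *: (idem k m i - zeta *: idem k m i.+1)) /\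
        (forall gamma : k,
           exists act : H -> vertex_alg k 'I_m -> vertex_alg k 'I_m,
             extends_rotation g act /\
             forall i : nat,
               act x (idem k m i)
               = (gamma * zeta ^+ i) *: (idem k m i - zeta *: idem k m i.+1))
    & (exists act : H -> vertex_alg k 'I_m -> vertex_alg k 'I_m,
         extends_rotation g act /\ inner_faithful act) <-> m = n].
Proof.
have n_gt0 : (0 < n)%N := ltnW n_ge2.
have m_gt0 : (0 < m)%N := dvdn_gt0 n_gt0 m_dvd_n.
case: m m_gt0 m_dvd_n => // m' _ m_dvd_n.
have comul_x := taft_comul_x taftH; have counit_x := taft_counit_x taftH.
have xg := taft_xg taftH.
have act_x0 : (m'.+1 < n)%N ->
    forall act : H -> vertex_alg k 'I_m'.+1 -> vertex_alg k 'I_m'.+1,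
    extends_rotation g act -> forall p, act x p = 0.
  move=> lt_mn act rot p; apply: (act_x_eq0 rot comul_x counit_x xg).
  rewrite -(expr0 zeta) (eq_prim_root_expr zeta_prim) mod0n.
  by rewrite modn_small.
split=> // [eq_mn | ].
  subst n; split=> [act rot | gamma].
    by exists (act x (idem k m'.+1 0) (inZp 0)); apply: act_x_idem xg n_ge2.
  exact: taft_action_exists.
split=> [[act [rot faith]] | eq_mn].
  apply/eqP; rewrite eqn_leq dvdn_leq //= leqNgt; apply/negP => lt_mn.
  have [p] := inner_faithful_x_neq0 n_ge2 taftH rot.1 faith.
  by case; apply: act_x0.
subst n; have [act [rot act_x]] := taft_action_exists 1 n_ge2 zeta_prim taftH.
exists act; split=> //; apply: (taft_inner_faithful n_ge2 zeta_prim taftH rot).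
by move=> i; rewrite act_x mul1r.
Qed.
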